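(* $\langle\mathrm{nwd}({}^\omega 2),\subseteq,\mathrm{nwd}({}^\omega 2)\rangle\equiv_{\mathrm T}\mathbf{Part}^*(\mathbb{C}_\omega)\equiv_{\mathrm T}\mathbf{Part}(\mathbb{C}_\omega)$.
   Context: $\mathrm{nwd}({}^\omega2)$ is the ideal of nowhere dense subsets of the Cantor space. $\mathbb{C}_\omega=\mathcal{B}({}^\omega2)/\mathcal{M}$ is the Cohen algebra (Borel sets modulo meagre sets), a c.c.c. Boolean algebra. A relational system is a triple $\mathbf{A}=\langle A_-,A,A_+\rangle$ with $A\subseteq A_-\times A_+$. A generalized Galois–Tukey connection from $\mathbf{A}$ to $\mathbf{B}=\langle B_-,B,B_+\rangle$ is a pair $\varphi_-\colon A_-\to B_-$, $\varphi_+\colon B_+\to A_+$ with $\langle\varphi_-(a),b\rangle\in B\Rightarrow\langle a,\varphi_+(b)\rangle\in A$ for all $a\in A_-,b\in B_+$. $\mathbf{A}\le_{\mathrm T}\mathbf{B}$ means such a connection exists, and $\mathbf{A}\equiv_{\mathrm T}\mathbf{B}$ means $\mathbf{A}\le_{\mathrm T}\mathbf{B}$ and $\mathbf{B}\le_{\mathrm T}\mathbf{A}$. For a c.c.c. Boolean algebra $\mathbb{B}$, $\mathrm{Part}(\mathbb{B})$ is the set of maximal antichains of $\mathbb{B}^+=\mathbb{B}\setminus\{\mathbb0\}$. For $A,B\in\mathrm{Part}(\mathbb{B})$: $A\le B$ if every $b\in B$ is below some $a\in A$; for finite $F\subseteq A$, $A^F=(A\setminus F)\cup\{\bigvee F\}$;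 $A\le^*B$ if $A^F\le B$ for some finite $F\subseteq A$. $\mathbf{Part}(\mathbb{B})=\langle\mathrm{Part}(\mathbb{B}),\le,\mathrm{Part}(\mathbb{B})\rangle$ and $\mathbf{Part}^*(\mathbb{B})=\langle\mathrm{Part}(\mathbb{B}),\le^*,\mathrm{Part}(\mathbb{B})\rangle$. *)

(* Defs.v *)
From HB Require Import structures.
From mathcomp Require Import all_boot all_order generic_quotient.
From mathcomp Require Import boolp classical_sets functions cardinality fsbigop.
From mathcomp Require Import topology measure cantor.

Set Implicit Arguments.
Unset Strict Implicit.
Unset Printing Implicit Defensive.

Local Open Scope classical_set_scope.

Record rel_system := RelSystem {
  rs_dom : Type;
  rs_cod : Type;
  rs_rel : rs_dom -> rs_cod -> Prop
}.

Definition galois_tukey (A B : rel_system)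
    (phim : rs_dom A -> rs_dom B) (phip : rs_cod B -> rs_cod A) : Prop :=
  forall (a : rs_dom A) (b : rs_cod B),
    rs_rel (phim a) b -> rs_rel a (phip b).

Definition tukey_le (A B : rel_system) : Prop :=
  exists (phim : rs_dom A -> rs_dom B) (phip : rs_cod B -> rs_cod A),
    galois_tukey phim phip.

Definition tukey_equiv (A B : rel_system) : Prop :=
  tukey_le A B /\ tukey_le B A.

Section Partitions.
Context {d : Order.disp_t} {B : ctbDistrLatticeType d}.
Implicit Types (X Y F : set B).

(* Antichains are taken in the forcing sense: distinct elements are
   incompatible, i.e. have meet zero. *)
Definition antichain X : Prop :=
  (forall x, X x -> x <> Order.bottom) /\
  (forall x y, X x -> X y -> x <> y -> Order.meet x y = Order.bottom).

Definition maximal_antichain X : Prop :=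
  antichain X /\ forall Y, antichain Y -> X `<=` Y -> Y = X.

Definition refines X Y : Prop :=
  forall y, Y y -> exists2 x, X x & (y <= x)%O.

(* For F = set0 this adds the zero of B to X, which is immaterial for
   [refines]. *)
Definition merge_block X F : set B :=
  (X `\` F) `|` [set \big[Order.join/Order.bottom]_(x \in F) x].

Definition almost_refines X Y : Prop :=
  exists F, [/\ finite_set F, F `<=` X & refines (merge_block X F) Y].

End Partitions.

Definition Part {d : Order.disp_t} (B : ctbDistrLatticeType d) : Type :=
  {X : set B | maximal_antichain X}.

Definition PartSys {d : Order.disp_t} (B : ctbDistrLatticeType d) : rel_system :=
  @RelSystem (Part B) (Part B) (fun X Y => refines (sval X) (sval Y)).

Definition PartStarSys {d : Order.disp_t} (B : ctbDistrLatticeType d) :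
    rel_system :=
  @RelSystem (Part B) (Part B) (fun X Y => almost_refines (sval X) (sval Y)).

Definition nowhere_dense {T : topologicalType} (A : set T) : Prop :=
  interior (closure A) = set0.

Definition nwd (T : topologicalType) : Type := {A : set T | nowhere_dense A}.

Definition NwdSys (T : topologicalType) : rel_system :=
  @RelSystem (nwd T) (nwd T) (fun A B => sval A `<=` sval B).

Definition meagre {T : topologicalType} (A : set T) : Prop :=
  exists2 F : nat -> set T,
    (forall n, nowhere_dense (F n)) & A = \bigcup_n F n.

Section Meagre.
Context {T : topologicalType}.
Implicit Types A B : set T.

Lemma nowhere_dense0 : nowhere_dense (@set0 T).
Proof. by rewrite /nowhere_dense closure0 interior0. Qed.

Lemma sub_nowhere_dense A B : A `<=` B -> nowhere_dense B -> nowhere_dense A.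
Proof.
move=> AB nB; rewrite /nowhere_dense -subset0 -[X in _ `<=` X]nB.
by apply: interiorS; exact: closureS.
Qed.

Lemma meagre0 : meagre (@set0 T).
Proof.
by exists (fun=> set0); [move=> _; exact: nowhere_dense0|rewrite bigcup0].
Qed.

Lemma sub_meagre A B : A `<=` B -> meagre B -> meagre A.
Proof.
move=> AB [F nF BE]; exists (fun n => A `&` F n).
  by move=> n; apply: sub_nowhere_dense (nF n) => x [].
by rewrite -setI_bigcupr -BE; apply/esym/setIidPl.
Qed.

Lemma meagreU A B : meagre A -> meagre B -> meagre (A `|` B).
Proof.
move=> [F nF ->] [G nG ->].
exists (fun n => if odd n then F n./2 else G n./2); first by move=> n; case: ifP.
apply/seteqP; split=> x.
- case=> -[n _ ?]; [exists (n.*2.+1) => //|exists (n.*2) => //].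
  + by rewrite /= odd_double uphalf_double.
  + by rewrite odd_double doubleK.
- by case=> n _; case: ifP => _ ?; [left|right]; exists n./2.
Qed.

End Meagre.

Section CategoryAlgebra.
Context {T : topologicalType}.

Definition borel : Type := {A : set T | A \in <<s @open T >>}.
Implicit Types A B C : borel.

Lemma borelP A : <<s @open T >> (val A).
Proof. by have := valP A; rewrite in_setE. Qed.

Definition borel_of (X : set T) (h : <<s @open T >> X) : borel :=
  exist _ X (mem_set h).

Lemma borelC_proof A : <<s @open T >> (~` val A).
Proof. by rewrite -setTD; exact: sigma_algebraCD (borelP A). Qed.

Lemma borelU_proof A B : <<s @open T >> (val A `|` val B).
Proof.
rewrite -bigcup2E; apply: sigma_algebra_bigcup => -[|[|n]] /=.
- exact: borelP.
- exact: borelP.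
- exact: sigma_algebra0.
Qed.

Definition borelC A : borel := borel_of (borelC_proof A).
Definition borelU A B : borel := borel_of (borelU_proof A B).

Lemma borelI_proof A B : <<s @open T >> (val A `&` val B).
Proof.
rewrite -[X in <<s _ >> X]setCK setCI.
exact: (borelP (borelC (borelU (borelC A) (borelC B)))).
Qed.

Definition borelI A B : borel := borel_of (borelI_proof A B).
Definition borel0 : borel := borel_of (@sigma_algebra0 T setT (@open T)).
Definition borelT : borel := borelC borel0.

Definition meagre_eq (A B : borel) : bool :=
  `[< meagre ((val A `\` val B) `|` (val B `\` val A)) >].

Lemma meagre_eqP A B :
  reflect (meagre (val A `\` val B) /\ meagre (val B `\` val A))
          (meagre_eq A B).
Proof.
apply: (iffP (asboolP _)) => [h|[h1 h2]]; last exact: meagreU.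
by split; apply: sub_meagre h => x; [left|right].
Qed.

Let meagre_eq_refl : reflexive meagre_eq.
Proof. by move=> A; apply/meagre_eqP; rewrite setDv; split; exact: meagre0. Qed.

Let meagre_eq_sym : symmetric meagre_eq.
Proof. by move=> A B; apply/meagre_eqP/meagre_eqP => -[]. Qed.

Lemma meagre_setD_trans (A B C : set T) :
  meagre (A `\` B) -> meagre (B `\` C) -> meagre (A `\` C).
Proof.
move=> h1 h2; apply: sub_meagre (meagreU h1 h2) => x [Ax nCx].
by have [Bx|nBx] := pselect (B x); [right|left].
Qed.

Let meagre_eq_trans : transitive meagre_eq.
Proof.
move=> B A C /meagre_eqP[h1 h2] /meagre_eqP[h3 h4]; apply/meagre_eqP.
by split; apply: meagre_setD_trans; eauto.
Qed.

Canonical meagre_eq_equiv :=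
  EquivRel meagre_eq meagre_eq_refl meagre_eq_sym meagre_eq_trans.

Local Open Scope quotient_scope.

Definition category_algebra : Type := {eq_quot meagre_eq}.
HB.instance Definition _ := Choice.on category_algebra.
HB.instance Definition _ := EqQuotient.on category_algebra.

Implicit Types x y z : category_algebra.

Definition ca_class (A : borel) : category_algebra := \pi_category_algebra A.

Lemma ca_classP A B :
  ca_class A = ca_class B <->
  meagre (val A `\` val B) /\ meagre (val B `\` val A).
Proof.
split=> [/eqmodP/meagre_eqP//|h].
by apply/eqmodP/meagre_eqP.
Qed.

Lemma ca_ind (P : category_algebra -> Prop) :
  (forall A, P (ca_class A)) -> forall x, P x.
Proof. by move=> h; elim/quotW. Qed.

Lemma ca_reprK x : ca_class (repr x) = x.
Proof. exact: reprK. Qed.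

Lemma ca_repr A :
  meagre (val (repr (ca_class A)) `\` val A) /\
  meagre (val A `\` val (repr (ca_class A))).
Proof. exact/ca_classP/ca_reprK. Qed.

Definition ca_meet x y := ca_class (borelI (repr x) (repr y)).
Definition ca_join x y := ca_class (borelU (repr x) (repr y)).
Definition ca_compl x := ca_class (borelC (repr x)).
Definition ca_bot := ca_class borel0.
Definition ca_top := ca_class borelT.

Lemma ca_meetE A B : ca_meet (ca_class A) (ca_class B) = ca_class (borelI A B).
Proof.
have [a1 a2] := ca_repr A; have [b1 b2] := ca_repr B.
apply/ca_classP; split => /=.
  by apply: sub_meagre (meagreU a1 b1) => t [[? ?] /not_andP[?|?]]; [left|right].
by apply: sub_meagre (meagreU a2 b2) => t [[? ?] /not_andP[?|?]]; [left|right].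
Qed.

Lemma ca_joinE A B : ca_join (ca_class A) (ca_class B) = ca_class (borelU A B).
Proof.
have [a1 a2] := ca_repr A; have [b1 b2] := ca_repr B.
apply/ca_classP; split => /=.
  by apply: sub_meagre (meagreU a1 b1) => t [[?|?] /not_orP[? ?]]; [left|right].
by apply: sub_meagre (meagreU a2 b2) => t [[?|?] /not_orP[? ?]]; [left|right].
Qed.

Lemma ca_complE A : ca_compl (ca_class A) = ca_class (borelC A).
Proof.
have [a1 a2] := ca_repr A.
apply/ca_classP; split => /=.
  by apply: sub_meagre a2 => t [? /contrapT].
by apply: sub_meagre a1 => t [? /contrapT].
Qed.

Lemma borel_inj A B : val A = val B -> A = B. Proof. exact: val_inj. Qed.

Fact category_display : Order.disp_t. Proof. exact: (Order.Disp tt tt). Qed.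

Let ca_le x y : bool := ca_meet x y == x.
Let ca_lt x y : bool := (y != x) && ca_le x y.

Let ca_meetC : commutative ca_meet.
Proof.
elim/ca_ind=> A; elim/ca_ind=> B; rewrite !ca_meetE.
by congr ca_class; apply: borel_inj; exact: setIC.
Qed.

Let ca_joinC : commutative ca_join.
Proof.
elim/ca_ind=> A; elim/ca_ind=> B; rewrite !ca_joinE.
by congr ca_class; apply: borel_inj; exact: setUC.
Qed.

Let ca_meetA : associative ca_meet.
Proof.
elim/ca_ind=> A; elim/ca_ind=> B; elim/ca_ind=> C; rewrite !ca_meetE.
by congr ca_class; apply: borel_inj; exact: setIA.
Qed.

Let ca_joinA : associative ca_join.
Proof.
elim/ca_ind=> A; elim/ca_ind=> B; elim/ca_ind=> C; rewrite !ca_joinE.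
by congr ca_class; apply: borel_inj; exact: setUA.
Qed.

Let ca_joinKI y x : ca_meet x (ca_join x y) = x.
Proof.
elim/ca_ind: x => A; elim/ca_ind: y => B; rewrite ca_joinE ca_meetE.
by congr ca_class; apply: borel_inj; apply/seteqP; split => t /=; tauto.
Qed.

Let ca_meetKU y x : ca_join x (ca_meet x y) = x.
Proof.
elim/ca_ind: x => A; elim/ca_ind: y => B; rewrite ca_meetE ca_joinE.
by congr ca_class; apply: borel_inj; apply/seteqP; split => t /=; tauto.
Qed.

Let ca_meetUl : left_distributive ca_meet ca_join.
Proof.
elim/ca_ind=> A; elim/ca_ind=> B; elim/ca_ind=> C.
rewrite ca_joinE !ca_meetE ca_joinE.
by congr ca_class; apply: borel_inj; exact: setIUl.
Qed.

Let ca_meetxx : idempotent_op ca_meet.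
Proof.
elim/ca_ind=> A; rewrite ca_meetE.
by congr ca_class; apply: borel_inj; exact: setIid.
Qed.

HB.instance Definition _ :=
  @Order.isMeetJoinDistrLattice.Build category_display category_algebra
    ca_le ca_lt ca_meet ca_join (fun _ _ => erefl) (fun _ _ => erefl)
    ca_meetC ca_joinC ca_meetA ca_joinA ca_joinKI ca_meetKU ca_meetUl ca_meetxx.

Let ca_le0x x : (ca_bot <= x)%O.
Proof.
elim/ca_ind: x => A; apply/eqP; rewrite [LHS]ca_meetE.
by congr ca_class; apply: borel_inj; exact: set0I.
Qed.

Let ca_lex1 x : (x <= ca_top)%O.
Proof.
elim/ca_ind: x => A; apply/eqP; rewrite [LHS]ca_meetE.
by congr ca_class; apply: borel_inj; rewrite /= setC0 setIT.
Qed.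

HB.instance Definition _ :=
  Order.hasBottom.Build category_display category_algebra ca_le0x.
HB.instance Definition _ :=
  Order.hasTop.Build category_display category_algebra ca_lex1.

Let ca_joinxC x : Order.join x (ca_compl x) = Order.top.
Proof.
elim/ca_ind: x => A; rewrite ca_complE [LHS]ca_joinE.
by congr ca_class; apply: borel_inj; rewrite /= setC0 setUCr.
Qed.

Let ca_meetxC x : Order.meet x (ca_compl x) = Order.bottom.
Proof.
elim/ca_ind: x => A; rewrite ca_complE [LHS]ca_meetE.
by congr ca_class; apply: borel_inj; rewrite /= setICr.
Qed.

HB.instance Definition _ :=
  Order.TBDistrLattice_hasComplement.Build category_display category_algebra
    ca_joinxC ca_meetxC.

Lemma ca_le_class A B :
  (ca_class A <= ca_class B)%O <-> meagre (val A `\` val B).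
Proof.
split=> [/eqP|h].
  rewrite [X in X = _]ca_meetE => /ca_classP[_] /=.
  by apply: sub_meagre => t [? nB]; split=> // -[].
apply/eqP; rewrite [LHS]ca_meetE; apply/ca_classP; split=> /=.
  by apply: sub_meagre meagre0 => t [[]].
by apply: sub_meagre h => t [? /not_andP[]].
Qed.

Lemma ca_class_bot A : ca_class A = Order.bottom <-> meagre (val A).
Proof.
split=> [/ca_classP[+ _]|h]; first by rewrite /= setD0.
by apply/ca_classP; rewrite /= setD0 set0D; split=> //; exact: meagre0.
Qed.

End CategoryAlgebra.

Arguments borel : clear implicits.
Arguments category_algebra : clear implicits.

Definition cohen_algebra : ctbDistrLatticeType category_display :=
  category_algebra cantor_space.

(* Main.v *)
Require Import Defs.
From mathcomp Require Import all_boot all_order boolp classical_sets.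
From mathcomp Require Import fsbigop measure.
From mathcomp Require Import topology cantor.

(** Work with the countable base of cylinders [cyl s], [s] a finite 0-1 word,
    whose classes are dense in the Cohen algebra because Borel sets have the
    Baire property. A maximal antichain [A] yields the words [s] whose class is
    below some member of [A]; these are dense under extension, so the union of
    their cylinders has nowhere dense complement. A nowhere dense set [N] yields
    the antichain of the shortest cylinders missing [N].

    If the antichain of [N] is almost refined by [A], every member of [A] is
    below a closed set missing [N], merging finitely many cylinders being
    harmless; hence [N] lies in the complement attached to [A]. Conversely,
    attach to [A] only the points [s000...] with [s] undecided. This set is
    nowhere dense, and if it is contained in [N], then a cylinder [cyl s]
    missing [N] must have [s] decided, since [s000...] is in [cyl s]. *)

Set Implicit Arguments.
Unset Strict Implicit.
Unset Printing Implicit Defensive.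

Import Order.TTheory.

Local Open Scope classical_set_scope.

(** * Meagre sets and the Baire property *)

Section BaireProperty.
Context {T : topologicalType}.
Implicit Types (A U : set T) (F : nat -> set T).

Lemma nowhere_dense_meagre A : nowhere_dense A -> meagre A.
Proof.
move=> nA; exists (fun=> A) => //.
by apply/seteqP; split=> [x Ax|x [n _]//]; exists 0.
Qed.

Lemma meagre_bigcup F : (forall n, meagre (F n)) -> meagre (\bigcup_n F n).
Proof.
move=> mF.
have /choice[G GP] : forall n, exists G : nat -> set T,
    (forall k, nowhere_dense (G k)) /\ F n = \bigcup_k G k.
  by move=> n; have [G nG FG] := mF n; exists G.
exists (fun n => if unpickle n is Some (i, j) then G i j else set0).
  move=> n; case: (unpickle n) => [[i j]|]; last exact: nowhere_dense0.
  by have [nG _] := GP i.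
apply/seteqP; split=> x.
  move=> [i _]; have [_ ->] := GP i => -[j _ Gij].
  by exists (pickle (i, j)) => //; rewrite pickleK.
move=> [n _]; case: (unpickle n) => [[i j]|//] Gij.
by exists i => //; have [_ ->] := GP i; exists j.
Qed.

(** The set is closed, and a neighbourhood inside it of one of its points would have to meet [U],
    which it avoids. *)
Lemma nowhere_dense_boundary U : open U -> nowhere_dense (closure U `\` U).
Proof.
move=> oU; rewrite /nowhere_dense -subset0 => x.
have cD : closed (closure U `\` U).
  by rewrite setDE; apply: closedI; [exact: closed_closure|exact: open_closedC].
rewrite -(closure_id _).1// => nbx.
have [clUx _] := nbhs_singleton nbx.
by have [y [Uy [_]]] := clUx _ nbx.
Qed.

Definition baire_property A : Prop :=
  exists U, [/\ open U, meagre (A `\` U) & meagre (U `\` A)].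

Lemma open_baire_property U : open U -> baire_property U.
Proof. by move=> oU; exists U; rewrite setDv; split=> //; exact: meagre0. Qed.

Lemma baire_property_sigma_algebra : sigma_algebra setT baire_property.
Proof.
split; first by apply: open_baire_property; exact: open0.
(* The exterior of [U] approximates the complement of [A]: the boundary of [U], lost on the way, is
   nowhere dense. *)
- move=> A [U [oU AU UA]]; exists (~` closure U); split.
  + by apply: closed_openC; exact: closed_closure.
  + have mb := nowhere_dense_meagre (nowhere_dense_boundary oU).
    apply: sub_meagre (meagreU UA mb) => x [[_ nAx] /contrapT clx].
    by have [Ux|nUx] := pselect (U x); [left|right].
  + apply: sub_meagre AU => x [nclx nAx]; split.
      by apply: contrapT => nA; apply: nAx.
    by move=> Ux; apply: nclx; exact: subset_closure.
- move=> F bF.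
  have /choice[U UP] : forall n, exists U,
      [/\ open U, meagre (F n `\` U) & meagre (U `\` F n)] by [].
  exists (\bigcup_n U n); split.
  + by apply: bigcup_open => n _; have [] := UP n.
  + apply: (@sub_meagre _ _ (\bigcup_n (F n `\` U n))).
      by move=> x [[n _ Fx] nU]; exists n => //; split=> // Ux; apply: nU; exists n.
    by apply: meagre_bigcup => n; have [] := UP n.
  + apply: (@sub_meagre _ _ (\bigcup_n (U n `\` F n))).
      by move=> x [[n _ Ux] nF]; exists n => //; split=> // Fx; apply: nF; exists n.
    by apply: meagre_bigcup => n; have [] := UP n.
Qed.

Lemma borel_baire_property (A : borel T) : baire_property (val A).
Proof.
(* The generated sigma-algebra is an intersection, so [borelP A] specializes to the sigma-algebra of
   sets with the Baire property. *)
apply: (borelP A); split; first exact: baire_property_sigma_algebra.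
exact: open_baire_property.
Qed.

Lemma open_borel U : open U -> <<s @open T >> U.
Proof. by move=> oU; exact: sub_sigma_algebra. Qed.

End BaireProperty.

(** * Cylinders of the Cantor space *)

Implicit Types (s t u : seq bool) (x y z : cantor_space) (N : set cantor_space).

Definition cyl s : set cantor_space :=
  [set x | forall i, i < size s -> x i = nth false s i].

Lemma cyl_nil x : cyl [::] x.
Proof. by []. Qed.

(** Because of the default value, [nth false s] is the point [s] followed by zeros. *)
Lemma cyl_nth s : cyl s (nth false s : cantor_space).
Proof. by []. Qed.

Lemma cyl_cat s t : cyl (s ++ t) `<=` cyl s.
Proof.
move=> x xst i si; have := xst i; rewrite size_cat nth_cat ltn_addr//.
by rewrite si; exact.
Qed.

Lemma cyl_sub s t x : cyl s x -> cyl t x -> size s <= size t -> cyl t `<=` cyl s.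
Proof.
move=> sx tx st y ty i si; have it := leq_trans si st.
by rewrite ty// -tx// sx.
Qed.

Lemma cyl_eq s t x : cyl s x -> cyl t x -> size s = size t -> cyl s = cyl t.
Proof.
move=> sx tx st; apply/seteqP.
by split; [apply: cyl_sub tx sx _|apply: cyl_sub sx tx _]; rewrite st.
Qed.

Lemma clopen_coord i (b : bool) : clopen [set x : cantor_space | x i = b].
Proof.
have c : continuous (fun x : cantor_space => x i).
  exact: (@proj_continuous nat (fun=> bool) i).
split.
- apply: (@open_comp _ _ (fun x : cantor_space => x i) [set b]).
    by move=> x _; exact: c.
  exact: discrete_open.
- apply: (@preimage_closed _ _ (fun x : cantor_space => x i) [set b]) => //.
  exact: discrete_closed.
Qed.

Lemma clopen_cyl s : clopen (cyl s).
Proof.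
elim/last_ind: s => [|s b [oI cI]].
  have -> : cyl [::] = setT by apply/seteqP; split.
  exact: clopenT.
have -> : cyl (rcons s b) = cyl s `&` [set x | x (size s) = b].
  apply/seteqP; split=> x.
    move=> xs; split.
      by apply: (@cyl_cat s [:: b]); rewrite cats1.
    by have := xs (size s); rewrite size_rcons nth_rcons ltnn eqxx; exact.
  move=> [xs xb] i; rewrite size_rcons nth_rcons ltnS leq_eqVlt.
  by move=> /orP[/eqP->|si]; [rewrite ltnn eqxx|rewrite si; exact: xs].
by have [? ?] := clopen_coord (size s) b; split; [exact: openI|exact: closedI].
Qed.

(** The sets [B n] generate a filter that converges to [x] in each coordinate, hence in the product
    topology. *)
Lemma nbhs_cantor x (A : set cantor_space) : nbhs x A ->
  exists n, forall y, (forall i, i < n -> y i = x i) -> A y.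
Proof.
pose B n : set cantor_space := [set y | forall i, i < n -> y i = x i].
pose F := filter_from [set: nat] B.
have FF : Filter F.
  apply: filter_from_filter; first by exists 0.
  move=> m n _ _; exists (maxn m n) => // y By.
  by split=> i ?; apply: By; rewrite leq_max; apply/orP; [left|right].
have : {ptws, F --> x}.
  apply/(@pointwise_cvgP nat bool F x FF) => i A' /nbhs_singleton A'x.
  by exists i.+1 => // y By; rewrite /= By.
by move=> Fx /Fx[n _ BA]; exists n => y By; exact: BA.
Qed.

Lemma cyl_ext s (O : set cantor_space) x : open O -> O x -> cyl s x ->
  exists t, cyl (s ++ t) `<=` O.
Proof.
move=> oO Ox sx; have /nbhs_cantor[n nO] : nbhs x O by exact: open_nbhs_nbhs.
(* The next [n] values of [x] suffice, whatever the length of [s]. *)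
exists (mkseq (fun i => x (size s + i)) n) => y yst; apply: nO => i ni.
rewrite yst; last by rewrite size_cat size_mkseq ltn_addl.
rewrite nth_cat; case: ltnP => si; first by rewrite sx.
by rewrite nth_mkseq ?subnKC// (leq_ltn_trans (leq_subr _ _)).
Qed.

Lemma nowhere_denseP N :
  nowhere_dense N <-> forall s, exists t, cyl (s ++ t) `&` N = set0.
Proof.
split=> [nN s|nN].
  have [y [sy cy]] : exists y, cyl s y /\ ~ closure N y.
    apply: contrapT => h.
    have : interior (closure N) (nth false s : cantor_space).
      apply: (@filterS _ _ _ (cyl s)).
        by move=> z sz; apply: contrapT => cz; apply: h; exists z.
      by apply: open_nbhs_nbhs; split; [exact: (clopen_cyl s).1|].
    by rewrite nN.
  have oC : open (~` closure N) by apply: closed_openC; exact: closed_closure.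
  have [t tC] := cyl_ext oC cy sy; exists t.
  by rewrite -subset0 => z [/tC cz Nz]; apply: cz; exact: subset_closure.
rewrite /nowhere_dense -subset0 => x ix.
have [t tC] := @cyl_ext [::] _ x (@open_interior _ (closure N)) ix (cyl_nil x).
(* The point [t ++ u] followed by zeros lies in [closure N], yet its neighbourhood [cyl (t ++ u)]
   misses [N]. *)
have [u uN] := nN t.
have /tC/interior_subset/(_ (cyl (t ++ u))) : cyl t (nth false (t ++ u) : cantor_space).
  by apply: (@cyl_cat t u).
case.
  by apply: open_nbhs_nbhs; split; [exact: (clopen_cyl _).1|].
by move=> z [Nz uz]; have : (cyl (t ++ u) `&` N) z by []; rewrite uN.
Qed.

(** Baire category argument: a growing chain of words starting at [s] avoids the sets [F n] one
    after the other, and its limit lies in [cyl s]. *)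
Theorem cyl_not_meagre s : ~ meagre (cyl s).
Proof.
move=> [F nF sF].
have /choice[g gP] : forall p : nat * seq bool, exists t,
    cyl (p.2 ++ t) `&` F p.1 = set0.
  by move=> [n t]; exact: (nowhere_denseP (F n)).1.
(* Stage [m] avoids [F m]; the appended [false] makes the words grow strictly, so that coordinate
   [i] is fixed by [u i.+1]. *)
pose u := fix u n := if n is m.+1 then rcons (u m ++ g (m, u m)) false else s.
have u_size n : n <= size (u n).
  by elim: n => //= n IH; rewrite size_rcons size_cat ltnS (leq_trans IH)// leq_addr.
have u_mono m k : exists t, u (m + k) = u m ++ t.
  elim: k => [|k [t IH]]; first by exists [::]; rewrite addn0 cats0.
  rewrite addnS /= IH -cats1 -!catA; eexists; reflexivity.
pose x : cantor_space := fun i => nth false (u i.+1) i.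
have xu n : cyl (u n) x.
  move=> i iu; rewrite /x.
  have [le|le] := leqP n i.+1.
    have [t] := u_mono n (i.+1 - n); rewrite subnKC// => ->.
    by rewrite nth_cat iu.
  have [t] := u_mono i.+1 (n - i.+1); rewrite subnKC ?(ltnW le)// => ->.
  by rewrite nth_cat (u_size i.+1).
have := xu 0; rewrite /= sF => -[n _ Fx].
have : (cyl (u n ++ g (n, u n)) `&` F n) x.
  by split=> //; apply: (@cyl_cat _ [:: false]); rewrite cats1; exact: (xu n.+1).
by rewrite (gP (n, u n)).
Qed.

Lemma open_meagre_set0 (O : set cantor_space) : open O -> meagre O -> O = set0.
Proof.
move=> oO mO; rewrite -subset0 => x Ox.
have [t tO] := @cyl_ext [::] _ x oO Ox (cyl_nil x).
by apply: (@cyl_not_meagre t); exact: sub_meagre mO.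
Qed.

(** * Cylinders in the Cohen algebra *)

Definition cyl_class s : cohen_algebra :=
  ca_class (borel_of (open_borel (clopen_cyl s).1)).

Lemma cyl_class_neq0 s : cyl_class s <> Order.bottom.
Proof. by move=> /ca_class_bot; exact: cyl_not_meagre. Qed.

Lemma le_cyl_class s t : cyl s `<=` cyl t -> (cyl_class s <= cyl_class t)%O.
Proof.
move=> st; apply/ca_le_class; apply: sub_meagre meagre0 => x [sx]; apply.
exact: st.
Qed.

Lemma eq_cyl_class s t : cyl s = cyl t -> cyl_class s = cyl_class t.
Proof. by move=> st; apply/le_anti; rewrite !le_cyl_class// st. Qed.

(** By the Baire property [a] is the class of an open set, nonempty since [a] is not zero. *)
Lemma cyl_class_dense (a : cohen_algebra) : a <> Order.bottom ->
  exists s, (cyl_class s <= a)%O.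
Proof.
elim/(@ca_ind cantor_space): a => A A0; have [U [oU AU UA]] := borel_baire_property A.
have [x Ux] : exists x, U x.
  apply: contrapT => h; apply: A0; apply/ca_class_bot.
  by apply: sub_meagre AU => x Ax; split=> // Ux; apply: h; exists x.
have [t tU] := @cyl_ext [::] _ x oU Ux (cyl_nil x).
exists t; apply/ca_le_class; apply: sub_meagre UA => y [ty nAy].
by split=> //; exact: tU.
Qed.

Lemma meet_cyl_class_neq0 (a : cohen_algebra) s :
  Order.meet a (cyl_class s) <> Order.bottom ->
  exists t, (cyl_class (s ++ t) <= a)%O.
Proof.
move=> /cyl_class_dense[u]; rewrite lexI => /andP[ua us].
have [x [ux sx]] : exists x, cyl u x /\ cyl s x.
  apply: contrapT => h; apply: (@cyl_not_meagre u).
  move: us => /ca_le_class; apply: sub_meagre => x ux.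
  by split=> // sx; apply: h; exists x.
have [t tu] := cyl_ext (clopen_cyl u).1 ux sx.
by exists t; apply: le_trans (le_cyl_class tu) ua.
Qed.

(** * Maximal antichains and nowhere dense sets *)

(** In forcing terms, the Cohen condition [s] decides which member of [A] the generic filter
    meets. *)
Definition decides (A : set cohen_algebra) s : Prop :=
  exists2 a, A a & (cyl_class s <= a)%O.

Lemma decides_sub (A : set cohen_algebra) s t :
  cyl t `<=` cyl s -> decides A s -> decides A t.
Proof.
move=> ts [a Aa sa]; exists a => //.
exact: le_trans (le_cyl_class ts) sa.
Qed.

(** Some member of [A] is compatible with [cyl_class s], since otherwise [cyl_class s] could be
    added to [A]. *)
Lemma decides_dense (A : set cohen_algebra) : maximal_antichain A ->
  forall s, exists t, decides A (s ++ t).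
Proof.
move=> [[A0 Adisj] Amax] s.
have [a [Aa /meet_cyl_class_neq0[t ta]]] :
    exists a, A a /\ Order.meet a (cyl_class s) <> Order.bottom.
  apply: contrapT => h.
  have disj a : A a -> Order.meet a (cyl_class s) = Order.bottom.
    by move=> Aa; apply: contrapT => na; apply: h; exists a.
  have As : A (cyl_class s).
    rewrite -(Amax (A `|` [set cyl_class s])); [by right| |by left].
    split; first by move=> a [/A0//|->]; exact: cyl_class_neq0.
    move=> a b [Aa|->] [Ab|->] ab; [exact: Adisj|exact: disj| |by []].
    by rewrite meetC; exact: disj.
  by apply: (@cyl_class_neq0 s); rewrite -(disj _ As) meetxx.
by exists t, a.
Qed.

Definition undecided_points (A : set cohen_algebra) : set cantor_space :=
  [set x | exists2 s, ~ decides A s & x = nth false s].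

(* Below a decided [s ++ t], only the points of proper prefixes remain, and
   these vanish from the index [size (s ++ t)] on. *)
Lemma nowhere_dense_undecided_points (A : set cohen_algebra) :
  maximal_antichain A -> nowhere_dense (undecided_points A).
Proof.
move=> mA; apply/nowhere_denseP => s; have [t dt] := decides_dense mA s.
exists (t ++ [:: true]); rewrite catA -subset0 => x [xst [u nu xu]].
have xst' := cyl_cat xst.
have [le|lt] := leqP (size (s ++ t)) (size u).
  apply: nu; apply: decides_sub dt; apply: (@cyl_sub _ _ x) => //.
  by rewrite xu; exact: cyl_nth.
have := xst (size (s ++ t)).
rewrite (size_cat (s ++ t)) addn1 ltnSn => /(_ isT).
by rewrite xu nth_cat ltnn subnn/= nth_default// ltnW.
Qed.

Definition undecided_set (A : set cohen_algebra) : set cantor_space :=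
  ~` \bigcup_(s in decides A) cyl s.

Lemma nowhere_dense_undecided_set (A : set cohen_algebra) :
  maximal_antichain A -> nowhere_dense (undecided_set A).
Proof.
move=> mA; apply/nowhere_denseP => s; have [t dt] := decides_dense mA s.
by exists t; rewrite -subset0 => x [xst]; apply; exists (s ++ t).
Qed.

Definition misses N s : Prop := cyl s `&` N = set0.

Lemma misses_sub N s t : cyl t `<=` cyl s -> misses N s -> misses N t.
Proof.
move=> ts Ns; rewrite /misses -subset0 => x [tx Nx].
by rewrite -Ns; split=> //; exact: ts.
Qed.

Definition min_misses N s : Prop :=
  misses N s /\ forall k, k < size s -> ~ misses N (take k s).

Lemma min_misses_exists N t : misses N t ->
  exists2 s, min_misses N s & cyl t `<=` cyl s.
Proof.
move=> Nt; pose P k := `[< misses N (take k t) >].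
have exP : exists k, P k by exists (size t); apply/asboolP; rewrite take_size.
case: (ex_minnP exP) => k /asboolP Nk kmin; exists (take k t); last first.
  by rewrite -{1}(cat_take_drop k t); exact: cyl_cat.
split=> // j; rewrite size_take_min leq_min => /andP[jk jt].
rewrite take_takel ?(ltnW jk)// => Nj.
by have := kmin j (asboolT Nj); rewrite leqNgt jk.
Qed.

(** Words with a common point are comparable, and minimality forbids a proper prefix that already
    misses [N]. *)
Lemma min_misses_cyl_eq N s t x : min_misses N s -> min_misses N t ->
  cyl s x -> cyl t x -> cyl s = cyl t.
Proof.
wlog st : s t / size s <= size t.
  move=> h ms mt sx tx; have [st|/ltnW ts] := leqP (size s) (size t).
    exact: h.
  by apply/esym; exact: h.
move=> [Ns _] [_ mt] sx tx; apply: (cyl_eq sx tx).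
apply/eqP; rewrite eqn_leq st leqNgt; apply/negP => lt.
apply: (mt _ lt); apply: misses_sub Ns.
have tx' : cyl (take (size s) t) x.
  by apply: (@cyl_cat _ (drop (size s) t)); rewrite cat_take_drop.
by apply: (cyl_sub sx tx'); rewrite size_takel.
Qed.

Definition min_misses_classes N : set cohen_algebra :=
  [set a | exists2 s, min_misses N s & a = cyl_class s].

Lemma min_misses_classes_maximal N : nowhere_dense N ->
  maximal_antichain (min_misses_classes N).
Proof.
move=> /nowhere_denseP nN; split.
  split; first by move=> a [s _ ->]; exact: cyl_class_neq0.
  move=> a b [s ms ->] [t mt ->] st; apply: contrapT => h; apply: st.
  apply: eq_cyl_class; apply: contrapT => st; apply: h.
  rewrite [LHS]ca_meetE; apply/ca_class_bot => /=.
  apply: sub_meagre meagre0 => x [sx tx].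
  by apply: st; exact: min_misses_cyl_eq ms mt sx tx.
move=> Y [Y0 Ydisj] sY; apply/seteqP; split=> // y Yy.
(* Both [y] and the minimal class found here lie above the nonzero class of [u ++ t], so they cannot
   be distinct members of [Y]. *)
have [u uy] := cyl_class_dense (Y0 _ Yy).
have [t /min_misses_exists[s ms us]] := nN u.
have Bs : min_misses_classes N (cyl_class s) by exists s.
suff -> : y = cyl_class s by [].
apply: contrapT => ys; apply: (@cyl_class_neq0 (u ++ t)).
apply/le_anti; rewrite le0x andbT -(Ydisj _ _ Yy (sY _ Bs) ys) lexI.
by rewrite (le_cyl_class us) andbT (le_trans _ uy)// le_cyl_class//; exact: cyl_cat.
Qed.

(** A nowhere dense [N] is invisible modulo meagre sets, so disjointness from [N] is recorded on a
    representative; closed ones are stable under finite joins. *)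
Definition closed_class_missing N (a : cohen_algebra) : Prop :=
  exists C : borel cantor_space,
    [/\ closed (val C), val C `&` N = set0 & a = ca_class C].

Lemma closed_class_missing0 N : closed_class_missing N Order.bottom.
Proof. by exists borel0; split=> //=; [exact: closed0|rewrite set0I]. Qed.

Lemma closed_class_missingU N (a b : cohen_algebra) :
  closed_class_missing N a -> closed_class_missing N b ->
  closed_class_missing N (Order.join a b).
Proof.
move=> [C [cC CN ->]] [D [cD DN ->]]; exists (borelU C D).
split=> /=; [exact: closedU|by rewrite setIUl CN DN setU0|exact: ca_joinE].
Qed.

Lemma closed_class_missing_cyl N s :
  misses N s -> closed_class_missing N (cyl_class s).
Proof.
move=> Ns; exists (borel_of (open_borel (clopen_cyl s).1)).
by split=> //; exact: (clopen_cyl s).2.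
Qed.

Lemma closed_class_missing_merge N (F : set cohen_algebra) a :
  F `<=` min_misses_classes N ->
  merge_block (min_misses_classes N) F a -> closed_class_missing N a.
Proof.
move=> FN; have cN b : min_misses_classes N b -> closed_class_missing N b.
  by move=> [s [Ns _] ->]; exact: closed_class_missing_cyl.
move=> [[/cN//]|->].
rewrite big_seq; apply: (big_ind (closed_class_missing N)).
- exact: closed_class_missing0.
- exact: closed_class_missingU.
(* The join ranges over a finite support contained in [F], or is empty when there is none. *)
- by move=> b; case: finite_supportP => // X XF _ _ bX; apply/cN/FN/XF.
Qed.

(** The cylinder minus the closed representative is open and meagre, hence empty: the order of the
    algebra becomes a true inclusion. *)
Lemma closed_class_missing_le N (a : cohen_algebra) s :
  closed_class_missing N a -> (cyl_class s <= a)%O -> misses N s.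
Proof.
move=> [C [cC CN ->]] /ca_le_class /= /open_meagre_set0 sC.
rewrite /misses -subset0 => x [sx Nx]; rewrite -CN; split=> //.
apply: contrapT => nCx; rewrite -[False]/(set0 x) -sC; first by split.
by rewrite setDE; apply: openI; [exact: (clopen_cyl s).1|exact: closed_openC].
Qed.

(** * The Tukey connections *)

Lemma tukey_le_trans (A B C : rel_system) :
  tukey_le A B -> tukey_le B C -> tukey_le A C.
Proof.
move=> [f [f' ff']] [g [g' gg']]; exists (g \o f), (f' \o g') => a c /= h.
by apply: ff'; exact: gg'.
Qed.

Lemma nwd_tukey_le_part_star :
  tukey_le (NwdSys cantor_space) (PartStarSys cohen_algebra).
Proof.
exists (fun N : nwd cantor_space => exist _ _ (min_misses_classes_maximal (svalP N))).
exists (fun A : Part cohen_algebra => exist _ _ (nowhere_dense_undecided_set (svalP A))).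
move=> [N nN] [A mA] /= [F [_ FN ref]] x Nx [s [a Aa sa] sx].
have [b /(closed_class_missing_merge FN) Nb ab] := ref _ Aa.
by rewrite -[False]/(set0 x) -(closed_class_missing_le Nb (le_trans sa ab)).
Qed.

Lemma part_star_tukey_le_part d (B : ctbDistrLatticeType d) :
  tukey_le (PartStarSys B) (PartSys B).
Proof.
exists id, id => X Y /= XY; exists set0; split=> //.
by move=> y /XY[x Xx yx]; exists x => //; left; split.
Qed.

Lemma part_tukey_le_nwd :
  tukey_le (PartSys cohen_algebra) (NwdSys cantor_space).
Proof.
exists (fun A : Part cohen_algebra => exist _ _ (nowhere_dense_undecided_points (svalP A))).
exists (fun N : nwd cantor_space => exist _ _ (min_misses_classes_maximal (svalP N))).
move=> [A mA] [N nN] /= AN _ [s [Ns _] ->].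
apply: contrapT => nd; rewrite -[False]/(set0 (nth false s : cantor_space)) -Ns.
by split=> //; apply: AN; exists s.
Qed.

Theorem theorem3p14 :
  tukey_equiv (NwdSys cantor_space) (PartStarSys cohen_algebra) /\
  tukey_equiv (PartStarSys cohen_algebra) (PartSys cohen_algebra).
Proof.
have np := nwd_tukey_le_part_star.
have pp := part_star_tukey_le_part cohen_algebra.
have pn := part_tukey_le_nwd.
(* The three connections form a cycle; the remaining inequalities are compositions along it. *)
do 2!split=> //.
- exact: tukey_le_trans pp pn.
- exact: tukey_le_trans pn np.
Qed.
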